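(* Let $G$ be a finite connected graph without boundary and let $S\subseteq V(G)$ be such that $G_{S\to\partial}$ is layerable. Then $\operatorname{Crit}(G)$ has at most $|S|-1$ invariant factors.
   Context: Graphs are undirected multigraphs with vertex set $V$ and set $E$ of oriented edges (each undirected edge gives $e$ and its reverse $\overline{e}$); $e_+$, $e_-$ are the starting and ending vertices of $e$. A $\partial$-graph is a graph with a partition $V=V^\circ\sqcup\partial V$ (interior and boundary vertices). $G_{S\to\partial}$ is the $\partial$-graph with the vertices and edges of $G$ and $\partial V=S$. The critical group of a finite connected graph is $\operatorname{Crit}(G)=\ker(\epsilon)/L_{\mathrm{std}}(\mathbb{Z}V)$, where $L_{\mathrm{std}}x=\sum_{e: e_+=x}(x-e_-)$ and $\epsilon:\mathbb{Z}V\to\mathbb{Z}$ sends each vertex to $1$; it is a finite abelian group. Its invariant factors are the integers $f_1\mid f_2\mid\dots\mid f_k$, $f_j>1$, with $\operatorname{Crit}(G)\cong\bigoplus_j\mathbb{Z}/f_j$. Simple layerable extensions: $G'$ is obtained from $G$ by (i) adjoining an isolated boundary vertex $x$ if $V(G')=V(G)\sqcup\{x\}$, $E(G')=E(G)$, $V^\circ(G')=V^\circ(G)$, and $x$ is a boundary vertex of $G'$ with no incident edges; (ii) adjoining a boundary spike $e$ if $V(G')=V(G)\sqcup\{e_+\}$, $E(G')=E(G)\sqcup\{e,\overline{e}\}$, $V^\circ(G')=V^\circ(G)\sqcup\{e_-\}$, where in $G'$ the vertex $e_-$ is interior and $e_+$ is a boundary vertex with no other incident edges (so $e_-\in\partial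 V(G)$); (iii) adjoining a boundary edge $e$ if $V(G')=V(G)$, $V^\circ(G')=V^\circ(G)$, $E(G')=E(G)\sqcup\{e,\overline{e}\}$ and both endpoints of $e$ are boundary vertices. A finite $\partial$-graph is layerable if it is obtained from $\varnothing$ by finitely many such operations. *)

(* Defs.v *)
From HB Require Import structures.
From mathcomp Require Import all_boot all_order all_algebra ring_quotient boolp.

Set Implicit Arguments.
Unset Strict Implicit.
Unset Printing Implicit Defensive.

Import Order.TTheory GRing.Theory Num.Theory.
Local Open Scope ring_scope.

(* Finite undirected multigraph given by its oriented edges: [esrc e] is e_+,
   [etgt e] is e_- and [erev e] is the reverse of e.  Parallel edges and
   self-loops are allowed; an undirected edge always yields two distinct
   oriented edges, also when it is a self-loop. *)
Record graph := Graph {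
  vert : finType;
  edge : finType;
  esrc : edge -> vert;
  etgt : edge -> vert;
  erev : edge -> edge;
  erevK : involutive erev;
  erev_neq : forall e, erev e != e;
  esrc_rev : forall e, esrc (erev e) = etgt e
}.

Definition adjacent (G : graph) : rel (vert G) :=
  fun x y => [exists e : edge G, (esrc e == x) && (etgt e == y)].

Definition connected_graph (G : graph) : Prop :=
  (0 < #|vert G|)%N /\ forall x y : vert G, connect (@adjacent G) x y.

(* A finite graph with boundary vertices [bnd]; the interior is the
   complement. *)
Record dgraph := DGraph {
  dgraph_graph :> graph;
  bnd : {set vert dgraph_graph}
}.

Definition interior (G : dgraph) : {set vert G} := ~: bnd G.

(* G_{S -> boundary} *)
Definition with_boundary (G : graph) (S : {set vert G}) : dgraph :=
  @DGraph G S.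

(* Inclusion of G into a larger graph, as injections on vertices and edges
   compatible with endpoints and reversal.  This makes the extensions below,
   hence layerability, independent of the names of vertices and edges. *)
Record inclusion (G G' : graph) := Inclusion {
  ivert : vert G -> vert G';
  iedge : edge G -> edge G';
  ivert_inj : injective ivert;
  iedge_inj : injective iedge;
  iedge_src : forall e, esrc (iedge e) = ivert (esrc e);
  iedge_tgt : forall e, etgt (iedge e) = ivert (etgt e);
  iedge_rev : forall e, erev (iedge e) = iedge (erev e)
}.

Definition vimage (G G' : graph) (i : inclusion G G') : {set vert G'} :=
  ivert i @: [set: vert G].
Definition eimage (G G' : graph) (i : inclusion G G') : {set edge G'} :=
  iedge i @: [set: edge G].

(* In the three definitions below, a condition [~: A = B] says that the
   ambient vertex or edge set is the disjoint union of A and B. *)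

Definition adjoins_isolated (G G' : dgraph) : Prop :=
  exists (i : inclusion G G') (x : vert G'),
    [/\ ~: vimage i = [set x],
        eimage i = [set: edge G'],
        interior G' = ivert i @: interior G,
        x \in bnd G'
      & forall e : edge G', (esrc e != x) && (etgt e != x)].

Definition adjoins_spike (G G' : dgraph) : Prop :=
  exists (i : inclusion G G') (e : edge G'),
    [/\ ~: vimage i = [set esrc e],
        ~: eimage i = [set e; erev e],
        interior G' = ivert i @: interior G :|: [set etgt e]
          /\ etgt e \in ivert i @: bnd G,
        esrc e \in bnd G'
      & forall e' : edge G', (esrc e' == esrc e) || (etgt e' == esrc e) ->
          e' \in [set e; erev e]].

Definition adjoins_edge (G G' : dgraph) : Prop :=
  exists (i : inclusion G G') (e : edge G'),
    [/\ vimage i = [set: vert G'],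
        ~: eimage i = [set e; erev e],
        interior G' = ivert i @: interior G,
        esrc e \in bnd G'
      & etgt e \in bnd G'].

Inductive layerable : dgraph -> Prop :=
| layerable_empty (G : dgraph) :
    #|vert G| = 0%N -> #|edge G| = 0%N -> layerable G
| layerable_isolated (G G' : dgraph) :
    layerable G -> adjoins_isolated G G' -> layerable G'
| layerable_spike (G G' : dgraph) :
    layerable G -> adjoins_spike G G' -> layerable G'
| layerable_edge (G G' : dgraph) :
    layerable G -> adjoins_edge G G' -> layerable G'.

(* The free abelian group ZV and its basis vectors. *)
Definition chain (G : graph) : Type := {ffun vert G -> int}.
HB.instance Definition _ (G : graph) :=
  GRing.Zmodule.copy (chain G) {ffun vert G -> int}.

Definition vchain (G : graph) (x : vert G) : chain G :=
  [ffun y => (y == x)%:Z].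

(* The homomorphism ZV -> Z sending each vertex to 1. *)
Definition eps (G : graph) (c : chain G) : int := \sum_x c x.

(* The Z-linear extension of x |-> \sum_(e : e_+ = x) (x - e_-). *)
Definition Lstd (G : graph) (c : chain G) : chain G :=
  \sum_x (\sum_(e : edge G | esrc e == x) (vchain x - vchain (etgt e))) *~ c x.

Fact eps_is_zmod_morphism G : zmod_morphism (@eps G).
Proof.
by move=> c d; rewrite /eps -sumrB; apply: eq_bigr => x _; rewrite !ffunE.
Qed.
HB.instance Definition _ (G : graph) :=
  GRing.isZmodMorphism.Build (chain G) int (@eps G) (@eps_is_zmod_morphism G).

Fact Lstd_is_zmod_morphism G : zmod_morphism (@Lstd G).
Proof.
move=> c d; rewrite /Lstd -sumrB; apply: eq_bigr => x _.
by rewrite !ffunE mulrzBr.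
Qed.
HB.instance Definition _ (G : graph) :=
  GRing.isZmodMorphism.Build (chain G) (chain G) (@Lstd G)
    (@Lstd_is_zmod_morphism G).

Definition ker_eps (G : graph) : {pred chain G} := [pred c | eps c == 0].

Fact ker_eps_zmod_closed G : zmod_closed (@ker_eps G).
Proof.
split=> [|c d]; rewrite !inE ?raddf0 // raddfB /=.
by move=> /eqP-> /eqP->; rewrite subrr.
Qed.
HB.instance Definition _ (G : graph) :=
  GRing.isZmodClosed.Build (chain G) (@ker_eps G) (@ker_eps_zmod_closed G).

(* ker(eps) as an abelian group. *)
Record chain0 (G : graph) := Chain0 {
  chain0_val :> chain G;
  chain0P : chain0_val \in @ker_eps G
}.
HB.instance Definition _ (G : graph) := [isSub for @chain0_val G].
HB.instance Definition _ (G : graph) := [Choice of chain0 G by <:].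
HB.instance Definition _ (G : graph) :=
  [SubChoice_isSubZmodule of chain0 G by <:].

Fact eps_vchain G (x : vert G) : eps (vchain x) = 1.
Proof.
rewrite /eps (bigD1 x) //= ffunE eqxx big1 ?addr0 // => y /negPf yx.
by rewrite ffunE yx.
Qed.

Fact Lstd_ker_eps G (c : chain G) : Lstd c \in @ker_eps G.
Proof.
rewrite inE raddf_sum big1 // => x _; rewrite raddfMz raddf_sum big1 ?mul0rz //.
by move=> e _; rewrite raddfB /= !eps_vchain subrr.
Qed.

(* The subgroup L_std(ZV) of ker(eps). *)
Definition Lstd_image (G : graph) : {pred chain0 G} :=
  fun c => `[< exists b : chain G, \val c = Lstd b >].

Fact Lstd_image_zmod_closed G : zmod_closed (@Lstd_image G).
Proof.
split=> [|c d /asboolP[a ca] /asboolP[b db]]; apply/asboolP.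
  by exists 0; rewrite !raddf0.
by exists (a - b); rewrite Lstd_is_zmod_morphism -ca -db; exact: raddfB.
Qed.
HB.instance Definition _ (G : graph) :=
  GRing.isZmodClosed.Build (chain0 G) (@Lstd_image G)
    (@Lstd_image_zmod_closed G).

Definition Crit (G : graph) : zmodType :=
  Quotient.quot (@Lstd_image G : zmodClosed (chain0 G)).

(* [f] is the sequence of invariant factors of the abelian group [A].
   Addition on the product of the ['Z_(f`_j)] is written pointwise; since all
   entries of [f] exceed 1, ['Z_(f`_j)] really is Z/f_j. *)
Definition invariant_factors (A : zmodType) (f : seq nat) : Prop :=
  [/\ all (fun m => 1 < m)%N f,
      sorted dvdn f
    & exists phi : A -> {dffun forall j : 'I_(size f), 'Z_(nth 1%N f j)},
        bijective phi /\ forall x y j, phi (x + y) j = phi x j + phi y j].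

(* Main.v *)
From HB Require Import structures.
Require Import Defs.
From mathcomp Require Import all_boot all_order all_algebra.
From mathcomp Require Import ring_quotient boolp.
Import GRing.Theory.
Local Open Scope ring_scope.

(** Let [p] be a prime dividing every invariant factor of Crit(G), and let [k]
    be the number of invariant factors.  Reducing the cyclic factors mod [p]
    gives [k] linearly independent homomorphisms Crit(G) -> F_p.  A homomorphism
    [h] on ker(eps) which kills the image of the Laplacian yields a harmonic
    function on the whole of G, namely x |-> h(x - v0) for a base vertex [v0]
    ([harmonic_dipole]).  This function vanishes at [v0] and determines [h], so
    together with the constants the space of F_p-valued harmonic functions on G
    has dimension at least k + 1.

    On the other hand, a harmonic function vanishing on S is zero when
    G_{S -> boundary} is layerable ([layerable_harmonic_eq0]).  Indeed the last
    layer can be peeled off: across an adjoined edge the function takes equal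
    values at both ends (both are 0 for a boundary edge, and for a spike this is
    harmonicity at its free end), so deleting that edge preserves harmonicity,
    and the function still vanishes on the boundary of the smaller graph.  Hence
    restriction to S is injective on harmonic functions, and k + 1 <= #|S|
    ([independent_homs_lt_card]). *)

(** * Harmonic functions on layerable graphs *)

(** The Laplacian of a function with values in an abelian group. *)
Definition laplacian {A : zmodType} {G : graph} (u : vert G -> A)
    (x : vert G) : A :=
  \sum_(e : edge G | esrc e == x) (u x - u (etgt e)).

(** Harmonicity is required at every vertex, boundary vertices included. *)
Definition harmonic {A : zmodType} {G : graph} (u : vert G -> A) : Prop :=
  forall x, laplacian u x = 0.

(** Edges along which a function does not vary do not contribute to its
    Laplacian, so removing them preserves harmonicity. *)
Lemma harmonic_restrict (A : zmodType) (G G' : graph) (i : inclusion G G')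
    (u : vert G' -> A) :
  harmonic u ->
  (forall e, e \in ~: eimage i -> u (esrc e) = u (etgt e)) ->
  harmonic (u \o ivert i).
Proof.
move=> uh uE x; rewrite -[RHS](uh (ivert i x)) /laplacian.
rewrite [RHS](bigID (mem (eimage i))) /=.
rewrite [X in _ = _ + X]big1 ?addr0; last first.
  by move=> e /andP[/eqP <- eN]; rewrite uE ?subrr // inE.
rewrite [RHS](eq_bigl (fun e => (e \in eimage i) && (esrc e == ivert i x)));
  last by move=> e; rewrite andbC.
rewrite [RHS]big_mkcondr big_imset /=; last by move=> e1 e2 _ _ /iedge_inj.
rewrite -big_mkcondr /=; apply: eq_big => [e|e _].
  by rewrite inE iedge_src (inj_eq (@ivert_inj _ _ i)).
by rewrite iedge_tgt.
Qed.

(** A spike carries no variation of a harmonic function, since the Laplacian at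
    its free end only sees the spike. *)
Lemma harmonic_spike (A : zmodType) (G : graph) (u : vert G -> A) (e : edge G) :
  harmonic u -> etgt e != esrc e ->
  (forall e', (esrc e' == esrc e) || (etgt e' == esrc e) ->
     e' \in [set e; erev e]) ->
  u (esrc e) = u (etgt e).
Proof.
move=> uh eN eU; apply/eqP; rewrite -subr_eq0 -(uh (esrc e)) /laplacian.
rewrite (bigD1 e) //= big1 ?addr0 // => e' /andP[e's e'e].
have := eU e'; rewrite e's !inE (negPf e'e) => /(_ isT) /eqP e'E.
by move: e's; rewrite e'E esrc_rev (negPf eN).
Qed.

Lemma etgt_rev (G : graph) (e : edge G) : etgt (erev e) = esrc e.
Proof. by rewrite -esrc_rev erevK. Qed.

(** A function that does not vary along [e] does not vary along the reverse
    of [e] either. *)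
Lemma eq_ends_rev (T : Type) (G : graph) (u : vert G -> T) (e e' : edge G) :
  u (esrc e) = u (etgt e) -> e' \in [set e; erev e] ->
  u (esrc e') = u (etgt e').
Proof.
by move=> ue; rewrite !inE => /orP[]/eqP-> //; rewrite esrc_rev etgt_rev.
Qed.

Lemma mem_bnd_ivert (G G' : dgraph) (i : inclusion G G') (y : vert G) :
  interior G' = ivert i @: interior G ->
  (ivert i y \in bnd G') = (y \in bnd G).
Proof.
move=> intE; apply: negb_inj.
have -> : (ivert i y \notin bnd G') = (ivert i y \in interior G').
  by rewrite inE.
by rewrite intE mem_imset ?inE //; exact: ivert_inj.
Qed.

(** Uniqueness for the smaller graph gives uniqueness for the larger one, if the
    function is constant along the adjoined edges, zero at the adjoined vertices
    and zero on the boundary of the smaller graph. *)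
Lemma harmonic_eq0_inclusion (A : zmodType) (G G' : dgraph)
    (i : inclusion G G') (u : vert G' -> A) :
  (forall w : vert G -> A, harmonic w -> {in bnd G, forall y, w y = 0} ->
     forall y, w y = 0) ->
  harmonic u -> (forall e, e \in ~: eimage i -> u (esrc e) = u (etgt e)) ->
  {in bnd G, forall y, u (ivert i y) = 0} ->
  {in ~: vimage i, forall x, u x = 0} ->
  forall x, u x = 0.
Proof.
move=> uniqG uh uE ub uN x.
case: (boolP (x \in vimage i)) => [/imsetP[y _ ->]|xN]; last first.
  by apply: uN; rewrite inE.
by apply: (uniqG (u \o ivert i)) => //; exact: harmonic_restrict.
Qed.

(** A harmonic function vanishing on the boundary of a layerable graph is zero:
    induction on the layers. *)
Lemma layerable_harmonic_eq0 (A : zmodType) (G : dgraph) (u : vert G -> A) :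
  layerable G -> harmonic u -> {in bnd G, forall x, u x = 0} ->
  forall x, u x = 0.
Proof.
move=> lay; elim: lay u => {G}
  [G V0 _|G G' _ IH adj|G G' _ IH adj|G G' _ IH adj] u.
- by move=> _ _ x; have := fintype0 x V0.
- case: adj => i [x [vE eE intE xb _]] uh ub.
  apply: (harmonic_eq0_inclusion _ _ _ i _ IH) => //.
  + by move=> e; rewrite eE !inE.
  + by move=> y yb; apply: ub; rewrite (mem_bnd_ivert _ _ _ _ intE).
  + by move=> y; rewrite vE inE => /eqP->; exact: ub.
- case: adj => i [e [vE eE [intE _] sb eU]] uh ub.
  have ts : etgt e != esrc e.
    apply: contraTneq sb => <-.
    have : etgt e \in interior G' by rewrite intE !inE eqxx orbT.
    by rewrite inE.
  have ue := @harmonic_spike _ _ _ _ uh ts eU.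
  apply: (harmonic_eq0_inclusion _ _ _ i _ IH) => //.
  + by move=> e'; rewrite eE; exact: eq_ends_rev.
  (* The only new interior vertex is the base of the spike; there the value is
     that at the free end. *)
  + move=> y yb; have [->|yt] := eqVneq (ivert i y) (etgt e).
      by rewrite -ue ub.
    apply: ub; apply: contraLR yb => yb.
    have : ivert i y \in interior G' by rewrite inE.
    rewrite intE !inE (negPf yt) orbF mem_imset ?inE //; exact: ivert_inj.
  + by move=> y; rewrite vE inE => /eqP->; exact: ub.
- case: adj => i [e [vE eE intE sb tb]] uh ub.
  apply: (harmonic_eq0_inclusion _ _ _ i _ IH) => //.
  + by move=> e'; rewrite eE; apply: eq_ends_rev; rewrite !ub.
  + by move=> y yb; apply: ub; rewrite (mem_bnd_ivert _ _ _ _ intE).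
  + by move=> y; rewrite vE !inE.
Qed.

(** * Harmonic functions and homomorphisms on ker(eps) *)

Fact dipole_ker_eps {G : graph} (v0 x : vert G) :
  (vchain x - vchain v0 : chain G) \in @ker_eps G.
Proof. by rewrite inE raddfB /= !eps_vchain subrr. Qed.

(** The element x - v0 of ker(eps). *)
Definition dipole {G : graph} (v0 x : vert G) : chain0 G :=
  Chain0 (dipole_ker_eps v0 x).

(** The dipoles with a fixed base point generate ker(eps). *)
Lemma chain0_sum_dipole (G : graph) (v0 : vert G) (c : chain0 G) :
  c = \sum_x dipole v0 x *~ (c : chain G) x.
Proof.
have c0 : \sum_x (c : chain G) x = 0 by apply/eqP/(chain0P c).
apply/val_inj/ffunP => y; rewrite (raddf_sum val) /= sum_ffunE.
have E x : val (dipole v0 x *~ (c : chain G) x) y =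
    (y == x)%:Z * (c : chain G) x - (y == v0)%:Z * (c : chain G) x.
  by rewrite (raddfMz val) /= ffunMzE !ffunE mulrzz mulrBl.
under eq_bigr do rewrite E.
rewrite sumrB -mulr_sumr c0 mulr0 subr0 (bigD1 y) //= eqxx mul1r.
by rewrite big1 ?addr0 // => x; rewrite eq_sym => /negPf ->; rewrite mul0r.
Qed.

(** A homomorphism on ker(eps) killing the image of the Laplacian is, on the
    dipoles with a fixed base point, a harmonic function of the other end. *)
Lemma harmonic_dipole (A : zmodType) (G : graph) (h : {additive chain0 G -> A})
    (v0 : vert G) :
  (forall (c : chain0 G) (b : chain G), val c = Lstd b -> h c = 0) ->
  harmonic (fun x => h (dipole v0 x)).
Proof.
move=> hL x; rewrite /laplacian.
under eq_bigr do rewrite -raddfB.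
rewrite -raddf_sum; apply: (hL _ (vchain x)).
rewrite (raddf_sum val) /Lstd (bigD1 x) //= ffunE eqxx mulr1z.
rewrite [X in _ = _ + X]big1 ?addr0 => [|y /negPf yx]; last by rewrite ffunE yx.
by apply: eq_bigr => e _; rewrite opprB addrA subrK.
Qed.

Lemma harmonic_lin_comb (F : fieldType) (G : graph) (I : finType)
    (a : I -> F) (u : I -> vert G -> F) (b : F) :
  (forall i, harmonic (u i)) -> harmonic (fun x => b + \sum_i a i * u i x).
Proof.
move=> uh x; rewrite /laplacian.
under eq_bigr => e _.
  rewrite opprD addrACA subrr add0r -sumrB.
  by under eq_bigr do rewrite -mulrBr; over.
rewrite exchange_big big1 //= => i _.
by rewrite -mulr_sumr [X in _ * X](uh i x) mulr0.
Qed.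

(** Restricting to S the constant 1 and the harmonic functions attached to k
    independent homomorphisms gives k + 1 independent vectors. *)
Lemma independent_homs_lt_card (F : fieldType) (G : graph) (S : {set vert G})
    (k : nat) (h : 'I_k -> {additive chain0 G -> F}) :
  (0 < #|vert G|)%N -> layerable (with_boundary S) ->
  (forall j (c : chain0 G) (b : chain G), val c = Lstd b -> h j c = 0) ->
  (forall a : 'I_k -> F, (forall c, \sum_j a j * h j c = 0) ->
     forall j, a j = 0) ->
  (k < #|S|)%N.
Proof.
move=> /card_gt0P[v0 _] lay hL hfree.
(* Row 0 is the constant function 1, and row j + 1 comes from [h j]. *)
pose M : 'M[F]_(k.+1, #|S|) := \matrix_(i, s)
  if unlift ord0 i is Some j then h j (dipole v0 (enum_val s)) else 1.
suff: row_free M by rewrite /row_free => /eqP <-; exact: rank_leq_col.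
apply: inj_row_free => v vM0.
pose a (j : 'I_k) : F := v ord0 (lift ord0 j).
(* [u] is the function on all of G whose restriction to S is [v *m M]. *)
pose u x := v ord0 ord0 + \sum_j a j * h j (dipole v0 x).
have u0 : forall x, u x = 0.
  apply: (@layerable_harmonic_eq0 F (with_boundary S)) => // [|x xS].
    by apply: harmonic_lin_comb => j; apply: harmonic_dipole (hL j).
  have := congr1 (fun A : 'rV_#|S| => A ord0 (enum_rank_in xS x)) vM0.
  rewrite !mxE big_ord_recl mxE unlift_none mulr1 => <-; congr (_ + _).
  by apply: eq_bigr => j _; rewrite mxE liftK enum_rankK_in.
(* The dipole at the base point is 0, so [u v0] is the constant term. *)
have v00 : v ord0 ord0 = 0.
  rewrite -(u0 v0) /u big1 ?addr0 // => j _.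
  have -> : dipole v0 v0 = 0 by apply: val_inj; rewrite /= subrr.
  by rewrite raddf0 mulr0.
have a0 : forall j, a j = 0.
  apply: hfree => c; rewrite (chain0_sum_dipole _ v0 c).
  under eq_bigr do rewrite raddf_sum mulr_sumr.
  rewrite exchange_big big1 //= => x _.
  under eq_bigr do rewrite raddfMz mulrzAr.
  rewrite -mulrz_suml; have := u0 x.
  by rewrite /u v00 add0r => ->; rewrite mul0rz.
apply/rowP => i; rewrite mxE.
by case: (unliftP ord0 i) => [j|] ->; [exact: a0 | exact: v00].
Qed.

(** * Reduction modulo a common prime factor *)

(** The factors are all multiples of the first one; without factors any prime
    does, and 2 is taken. *)
Lemma common_prime_divisor (f : seq nat) :
  all (fun m => 1 < m)%N f -> sorted dvdn f ->
  exists2 p, prime p & forall m, m \in f -> (p %| m)%N.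
Proof.
case: f => [|m f] /=; first by exists 2.
move=> /andP[m1 _] mf; exists (pdiv m); first exact: pdiv_prime.
move=> n; rewrite inE => /orP[/eqP->|nf]; first exact: pdiv_dvd.
apply: dvdn_trans (pdiv_dvd m) _.
have dT : transitive dvdn by move=> y x z; exact: dvdn_trans.
exact: (allP (order_path_min dT mf)).
Qed.

(** Reduction 'Z_m -> 'F_p is additive when p divides m. *)
Lemma Zp_reductionD (p m : nat) (x y : 'Z_m) :
  prime p -> (1 < m)%N -> (p %| m)%N ->
  (x + y)%R%:R = x%:R + y%:R :> 'F_p.
Proof.
move=> pp m1 pm; rewrite -natrD.
(* Addition in 'Z_m is modulo (Zp_trunc m).+2, which equals m as 1 < m. *)
have -> : nat_of_ord (x + y)%R = ((nat_of_ord x + nat_of_ord y) %% m)%N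
  by exact: (congr1 (modn _) (Zp_cast m1)).
rewrite [in RHS](divn_eq (nat_of_ord x + nat_of_ord y)%N m) natrD natrM.
have -> : m%:R = 0 :> 'F_p by apply/eqP; rewrite -(dvdn_pcharf (pchar_Fp pp)).
by rewrite mulr0 add0r.
Qed.

Theorem corollary5p26 (G : graph) (S : {set vert G})
    (Gconn : connected_graph G)
    (Slay : layerable (with_boundary S))
    (f : seq nat) (fE : invariant_factors (Crit G) f) :
  (size f)%:Z <= #|S|%:Z - 1.
Proof.
case: fE => f1 fdvd [phi [[psi psiK phiK] phiD]].
have [p pp pf] := common_prime_divisor f f1 fdvd.
pose g j (q : Crit G) : 'F_p := (phi q j : nat)%:R.
have gD j : {morph g j : x y / x + y}.
  move=> x y; rewrite /g phiD Zp_reductionD //.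
    by apply: (allP f1); rewrite mem_nth.
  by apply: pf; rewrite mem_nth.
(* The characters of ker(eps) obtained from the cyclic factors mod [p]. *)
pose chi j (c : chain0 G) := g j (\pi_(Crit G) c)%qT.
have chiD j : {morph chi j : x y / x + y} by move=> x y; rewrite /chi raddfD gD.
have chi0 j : chi j 0 = 0 by apply: (@addrI _ (chi j 0)); rewrite -chiD !addr0.
have chiA j : zmod_morphism (chi j).
  by move=> x y; apply: (@addIr _ (chi j y)); rewrite -chiD !subrK.
pose h j : {additive chain0 G -> 'F_p} :=
  HB.pack (chi j) (GRing.isZmodMorphism.Build _ _ (chi j) (chiA j)).
rewrite Num.Theory.lerBrDr -PoszD lez_nat addn1.
apply: (@independent_homs_lt_card 'F_p G S (size f) h) => //.
- by case: Gconn.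
- move=> j c b cL; rewrite -[LHS]/(chi j c) -(chi0 j) /chi; congr (g j _); apply/eqP.
  by rewrite -Quotient.idealrBE subr0; apply/asboolP; exists b.
- move=> a a0 j.
  (* By surjectivity of [phi] some class has coordinates (0, .., 1, .., 0). *)
  pose d : {dffun forall i : 'I_(size f), 'Z_(nth 1%N f i)} :=
    [ffun i => if i == j then 1 else 0].
  have := a0 (repr (psi d)); rewrite (bigD1 j) //= big1 ?addr0.
    by rewrite /chi reprK /g phiK ffunE eqxx mulr1.
  by move=> i /negPf ij; rewrite /chi reprK /g phiK ffunE ij mulr0.
Qed.
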